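(* Let $G=(V,E)$ be a graph. Then, for every integer $k$ with $1\le k\le |V|$, \[ \sum_{i=1}^k \lambda_i(L(G))\le |E|+2k^2-\left\lceil\frac{k}{2}\right\rceil . \]
   Context: Graphs are finite, simple and undirected, with non-empty vertex set. The Laplacian matrix $L(G)$ of $G=(V,E)$ is the $|V|\times|V|$ matrix with $L(G)_{u,u}=\deg(u)$, $L(G)_{u,v}=-1$ if $\{u,v\}\in E$, and $L(G)_{u,v}=0$ otherwise. For $1\le i\le |V|$, $\lambda_i(L(G))$ denotes the $i$-th largest eigenvalue of $L(G)$ (counted with multiplicity). *)

(* Defs.v *)
From HB Require Import structures.
From mathcomp Require Import all_boot all_order all_algebra.
From mathcomp Require Import polyrcf complex.

Set Implicit Arguments.
Unset Strict Implicit.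
Unset Printing Implicit Defensive.

Import Order.TTheory GRing.Theory Num.Theory.
Local Open Scope ring_scope.

Section Graph.
Variables (V : finType) (e : rel V).

Definition edge_set : {set {set V}} :=
  [set [set p.1; p.2] | p : V * V & e p.1 p.2].

Definition degree (u : V) : nat := #|[set v | e u v]|.

(* Rows and columns are indexed by 'I_#|V|, identified with V by enum_val. *)
Definition laplacian (R : nzRingType) : 'M[R]_#|V| :=
  \matrix_(i, j)
    let u := enum_val i in
    let v := enum_val j in
    if u == v then (degree u)%:R
    else if e u v then -1 else 0.

End Graph.

Section Eigenvalues.
Variable R : rcfType.

(* The eigenvalues of A lying in R, in nonincreasing order, each repeated
   according to its multiplicity as a root of the characteristic polynomial.
   For a symmetric A these are all of its eigenvalues, see
   char_poly_eigenvalues below. *)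
Definition eigenvalues n (A : 'M[R]_n) : seq R :=
  sort >=%R
    (flatten [seq nseq (mup x (char_poly A)) x | x <- rootsR (char_poly A)]).

(* The i-th largest eigenvalue, for 1 <= i <= n (numbered from 1). *)
Definition lambda n (A : 'M[R]_n) (i : nat) : R := (eigenvalues A)`_i.-1.

Lemma mup_prod_XsubC (x : R) (s : seq R) :
  mup x (\prod_(y <- s) ('X - y%:P)) = count_mem x s.
Proof.
elim: s => [|y s IHs]; first by rewrite big_nil mupNroot // root1.
rewrite big_cons mupM ?polyXsubC_eq0 ?monic_neq0 ?monic_prod_XsubC //.
by rewrite IHs -['X - _]expr1 mup_XsubCX /= eq_sym; case: (y == x).
Qed.

Lemma perm_eigenvalues n (A : 'M[R]_n) (s : seq R) :
  char_poly A = \prod_(x <- s) ('X - x%:P) -> perm_eq (eigenvalues A) s.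
Proof.
move=> def_s; rewrite perm_sort; apply/allP => x _ /=; apply/eqP.
set p := char_poly A; have p_neq0 : p != 0 by rewrite monic_neq0 ?char_poly_monic.
have p_mup : count_mem x s = mup x p by rewrite /p def_s mup_prod_XsubC.
rewrite p_mup count_flatten -map_comp sumnE big_map.
under eq_bigr do rewrite /= count_nseq.
have rootE : (x \in rootsR p) = root p x.
  by rewrite -roots_on_rootsR // in_itv.
have [px | npx] := boolP (root p x); last first.
  rewrite mupNroot // big_seq big1 // => y y_p.
  rewrite /=; have [yx | //] := eqVneq x y; move: y_p; rewrite -yx.
  by rewrite rootE (negPf npx).
rewrite (bigD1_seq x) ?rootE ?uniq_roots //= eqxx mul1n big1 ?addn0 // => y.
by rewrite eq_sym => /negPf ->.
Qed.

Lemma char_poly_sym_split n (A : 'M[R]_n) : A^T = A ->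
  exists s : seq R, char_poly A = \prod_(x <- s) ('X - x%:P).
Proof.
move=> symA; pose toC := real_complex R; pose B := map_mx toC A.
have hermB : B \is hermsymmx.
  apply/is_hermitianmxP; rewrite expr0 scale1r.
  apply/matrixP => i j; rewrite !mxE -[in RHS]symA mxE.
  by rewrite [RHS]conjc_real.
have normB := hermitian_normalmx hermB.
have /(orthomx_spectralP) defB := normB.
have /mxOverP d_real := hermitian_spectral_diag_real hermB.
set d := spectral_diag B in defB d_real; set P := spectralmx B in defB.
exists [seq complex.Re (d 0 i) | i <- enum 'I_n].
apply: (map_poly_inj (real_complex R)); rewrite map_char_poly -/toC -/B.
rewrite rmorph_prod big_map big_enum /=.
under eq_bigr do
  rewrite rmorphB /= map_polyX map_polyC /= RRe_real ?d_real //.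
have -> : char_poly B = char_poly (diag_mx d).
  have Pu : P \in unitmx by exact: spectral_unit.
  rewrite defB /char_poly /char_poly_mx.
  set Q := map_mx polyC P; set D := map_mx polyC (diag_mx d).
  have Qu : map_mx polyC (invmx P) *m Q = 1%:M.
    by rewrite -map_mxM mulVmx // map_mx1.
  have -> : 'X%:M - map_mx polyC (invmx P *m diag_mx d *m P)
            = map_mx polyC (invmx P) *m ('X%:M - D) *m Q.
    rewrite mulmxBr mulmxBl !map_mxM; congr (_ - _).
    by rewrite -mulmxA mul_scalar_mx -scalemxAr Qu scalemx1.
  rewrite !det_mulmx mulrAC -det_mulmx Qu det1 mul1r //.
rewrite char_poly_trig ?diag_mx_is_trig //.
by apply: eq_bigr => i _; rewrite mxE eqxx.
Qed.

Lemma char_poly_eigenvalues n (A : 'M[R]_n) : A^T = A ->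
  char_poly A = \prod_(x <- eigenvalues A) ('X - x%:P).
Proof.
move=> /char_poly_sym_split[s def_s].
by rewrite (perm_big s) ?perm_eigenvalues.
Qed.

Lemma size_eigenvalues n (A : 'M[R]_n) : A^T = A -> size (eigenvalues A) = n.
Proof.
move=> /char_poly_eigenvalues /(congr1 (size \o val)) /=.
by rewrite size_char_poly size_prod_XsubC => -[].
Qed.

Lemma sorted_eigenvalues n (A : 'M[R]_n) : sorted >=%R (eigenvalues A).
Proof. by apply: sort_sorted => x y; exact: le_total. Qed.

End Eigenvalues.

Lemma tr_laplacian (V : finType) (e : rel V) (R : nzRingType) :
  symmetric e -> (laplacian e R)^T = laplacian e R.
Proof.
move=> sym_e; apply/matrixP => i j; rewrite !mxE /= eq_sym sym_e.
by case: eqP => // ->.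
Qed.

(* Main.v *)
Require Import Defs.
From mathcomp Require Import all_boot all_order all_algebra.
From mathcomp Require Import complex ring lra zify.

(* Let P be the orthogonal projection onto the span of eigenvectors for the k
   largest eigenvalues.  The sum of these eigenvalues is the trace of P L, that
   is, the sum over the edges uv of the weight w(uv), the value of the quadratic
   form of P at 1_u - 1_v, and 0 <= w <= 2.  Hence it suffices to bound the sum
   of w - 1 over the graph F of the edges with w > 1.  A matching of F has total
   weight at most 2 tr P = 2k, hence fewer than 2k edges.  On the other hand the
   sum of w - 1 over F is at most k nu + floor(k/2), where nu is the matching
   number of F.  This follows the proof of the Tutte-Berge formula: deleting a
   vertex covered by all maximum matchings lowers nu by 1 and the sum by at most
   k, as the edges form a star; once there is no such vertex, Gallai's argument
   splits F into parts, without edges between them, of at most 2 nu + 1 vertices.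
   Then the total weight is at most (2 nu + 1) k, so that for m edges the sum of
   w - 1 is at most min((2 nu + 1) k - m, m).  Finally,
   k (2k - 1) + floor(k/2) = 2k^2 - ceil(k/2). *)

Set Implicit Arguments.
Unset Strict Implicit.
Unset Printing Implicit Defensive.

Import Order.TTheory GRing.Theory Num.Theory.
Local Open Scope ring_scope.
Local Open Scope sesquilinear_scope.

(** * Real parts of spectral projections *)

Section RealParts.
Variable R : rcfType.

(* The conditions on p that hold for the real part of a complex orthogonal
   projection of rank k; idempotence is lost, but the row bound survives. *)
Record real_part_projection (V : finType) (k : nat) (p : V -> V -> R) : Prop :=
  RealPartProjection {
    rpp_sym : forall u v, p u v = p v u;
    rpp_trace : \sum_v p v v = k%:R;
    rpp_ge0 : forall x : V -> R, 0 <= \sum_u \sum_v x u * x v * p u v;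
    rpp_le1 : forall x : V -> R,
      \sum_u \sum_v x u * x v * p u v <= \sum_u x u ^+ 2;
    rpp_row : forall u, \sum_v p u v ^+ 2 <= p u u
  }.

Lemma Re_sum (I : finType) (F : I -> R[i]) :
  complex.Re (\sum_i F i) = \sum_i complex.Re (F i).
Proof. by apply: (big_morph (@complex.Re R)) => // -[a b] [c d]. Qed.

(** As H = H H^*, its entries are Hermitian inner products of its rows. Taking real parts turns
    these into inner products in R^(2n), so Re H is a real Gram matrix. *)
Lemma Re_gram n (H : 'M[R[i]]_n) : H ^t* = H -> H *m H = H ->
  forall i j, complex.Re (H i j) =
    \sum_l (complex.Re (H i l) * complex.Re (H j l)
            + complex.Im (H i l) * complex.Im (H j l)).
Proof.
move=> Hh HH i j; rewrite -{1}HH mxE Re_sum; apply: eq_bigr => l _.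
rewrite -{2}Hh !mxE.
by case: (H i l) => a b; case: (H j l) => c d /=; ring.
Qed.

Lemma gram_quad (I J : finType) (a : I -> J -> R) (x : I -> R) :
  \sum_i \sum_j x i * x j * (\sum_l a i l * a j l)
    = \sum_l (\sum_i x i * a i l) ^+ 2.
Proof.
transitivity (\sum_i \sum_j \sum_l (x i * a i l) * (x j * a j l)).
  do 2![apply: eq_bigr => ? _]; rewrite mulr_sumr.
  by apply: eq_bigr => l _; ring.
under eq_bigr do rewrite exchange_big /=.
rewrite exchange_big /=; apply: eq_bigr => l _; rewrite expr2 mulr_suml.
by apply: eq_bigr => i _; rewrite mulr_sumr.
Qed.

Lemma Re_projection_ge0 n (H : 'M[R[i]]_n) (x : 'I_n -> R) :
    H ^t* = H -> H *m H = H ->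
  0 <= \sum_i \sum_j x i * x j * complex.Re (H i j).
Proof.
move=> Hh HH.
under eq_bigr do under eq_bigr do rewrite Re_gram // big_split mulrDr /=.
under eq_bigr do rewrite big_split /=.
rewrite big_split !gram_quad /= addr_ge0 // sumr_ge0 // => l _; exact: sqr_ge0.
Qed.

Lemma Re_projectionP n k (H : 'M[R[i]]_n) :
    H ^t* = H -> H *m H = H -> \tr H = k%:R ->
  real_part_projection k (fun i j => complex.Re (H i j)).
Proof.
move=> Hh HH trH; split=> [i j||x|x|i].
- by rewrite -{1}Hh !mxE; case: (H j i).
- rewrite -Re_sum; move: trH; rewrite /mxtrace => ->.
  by rewrite -(rmorph_nat (real_complex R)).
- exact: Re_projection_ge0.
(* The upper bound is positivity for the complementary projection 1 - H. *)
- have Ch : (1%:M - H) ^t* = 1%:M - H.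
    by rewrite linearB /= map_mxB Hh tr_scalar_mx map_scalar_mx rmorph1.
  have CC : (1%:M - H) *m (1%:M - H) = 1%:M - H.
    by rewrite mulmxBr mulmx1 mulmxBl mul1mx HH subrr subr0.
  rewrite -subr_ge0; apply: le_trans (Re_projection_ge0 x Ch CC) _.
  rewrite le_eqVlt; apply/orP; left; apply/eqP; rewrite -sumrB.
  apply: eq_bigr => i _.
  rewrite (bigD1 i) //= [in RHS](bigD1 i) //= opprD addrA -sumrN.
  congr (_ + _).
    by rewrite !mxE eqxx; case: (H i i) => a b /=; ring.
  apply: eq_bigr => j /negPf ji; rewrite !mxE eq_sym ji.
  by case: (H i j) => a b /=; ring.
(* The diagonal entry is the squared norm of row i, imaginary parts included. *)
- rewrite [leRHS]Re_gram //; apply: ler_sum => j _; rewrite expr2 lerDl -expr2.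
  exact: sqr_ge0.
Qed.

Lemma sum_eigenvalues_subset n (A : 'M[R]_n) (d : 'I_n -> R) k :
    char_poly A = \prod_i ('X - (d i)%:P) -> (k <= n)%N ->
  exists2 I : {set 'I_n}, #|I| = k
    & \sum_(1 <= i < k.+1) lambda A i = \sum_(i in I) d i.
Proof.
move=> def_d k_le.
pose s := sort (relpre d >=%R) (enum 'I_n).
have eigE : eigenvalues A = map d s.
  rewrite -sort_map -[LHS](sorted_sort ge_trans (sorted_eigenvalues A)).
  apply/perm_sortP; [by move=> x y; exact: le_total | exact: ge_trans
    | exact: ge_anti | ].
  by apply: perm_eigenvalues; rewrite def_d big_map big_enum.
have size_s : size s = n by rewrite size_sort size_enum_ord.
have uniq_s : uniq s by rewrite sort_uniq enum_uniq.
exists [set i in take k s].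
  by rewrite cardsE (card_uniqP (take_uniq k uniq_s)) size_takel ?size_s.
rewrite big_add1 /= /lambda eigE.
rewrite (eq_bigl (mem (take k s))); last by move=> i; rewrite inE.
rewrite -big_uniq ?take_uniq //=.
(* [ord0] is to be the default of [nth], so n = 0 is treated apart. *)
case: n => [|n] in A d def_d k_le s eigE size_s uniq_s *.
  by move: k_le; rewrite leqn0 => /eqP->; rewrite take0 big_nil big_geq.
rewrite (big_nth ord0) size_takel ?size_s // !big_mkord.
apply: eq_bigr => i _; rewrite nth_take // (nth_map ord0) //.
by rewrite size_s (leq_trans _ k_le).
Qed.

Lemma sum_eigenvalues_projection n (A : 'M[R]_n) k :
    A^T = A -> (k <= n)%N ->
  exists2 p : 'I_n -> 'I_n -> R, real_part_projection k p
    & \sum_(1 <= i < k.+1) lambda A i = \sum_i \sum_j p i j * A i j.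
Proof.
move=> symA k_le; pose toC := real_complex R; pose B := map_mx toC A.
have hermB : B \is hermsymmx.
  apply/is_hermitianmxP; rewrite expr0 scale1r.
  by apply/matrixP => i j; rewrite !mxE -[in RHS]symA mxE [RHS]conjc_real.
have /orthomx_spectralP := hermitian_normalmx hermB.
have /mxOverP := hermitian_spectral_diag_real hermB.
have := spectral_unitarymx B.
move: (spectral_diag B) (spectralmx B) => d S S_unitary d_real.
have Su := unitarymx_unit S_unitary; have SK := mulmxV Su.
have S'K := mulVmx Su; rewrite invmx_unitary // in SK S'K * => defB.
have char_A : char_poly A = \prod_i ('X - (complex.Re (d 0 i))%:P).
  apply: (map_poly_inj toC); rewrite map_char_poly -/B rmorph_prod /=.
  under eq_bigr do
    rewrite rmorphB /= map_polyX map_polyC /= RRe_real ?d_real //.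
  have <- : char_poly (diag_mx d) = \prod_i ('X - (d 0 i)%:P).
    rewrite char_poly_trig ?diag_mx_is_trig //.
    by apply: eq_bigr => i _; rewrite mxE eqxx.
  rewrite /char_poly /char_poly_mx.
  have -> : 'X%:M - map_mx polyC B = map_mx polyC (S ^t*)
      *m ('X%:M - map_mx polyC (diag_mx d)) *m map_mx polyC S.
    rewrite mulmxBr mulmxBl -!map_mxM -defB; congr (_ - _).
    by rewrite scalar_mxC -mulmxA -map_mxM S'K map_mx1 mulmx1.
  by rewrite !det_mulmx mulrAC -det_mulmx -map_mxM S'K map_mx1 det1 mul1r.
have [I cardI ->] := sum_eigenvalues_subset char_A k_le.
(* [H] projects onto the span of the eigenvectors selected by [I], so the trace of [H *m B] adds up
   their eigenvalues. As [A] is real, only Re H contributes to the real part. *)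
pose D : 'M[R[i]]_n := diag_mx (\row_i (i \in I)%:R).
pose H := S ^t* *m D *m S.
have DD : D *m D = D.
  rewrite mulmx_diag; congr diag_mx; apply/rowP => i; rewrite !mxE.
  by case: (i \in I); rewrite ?mulr1 ?mulr0.
have Dh : D ^t* = D.
  rewrite tr_diag_mx map_diag_mx; congr diag_mx; apply/rowP => i.
  by rewrite !mxE rmorph_nat.
exists (fun i j => complex.Re (H i j)).
  apply: Re_projectionP.
  - by rewrite /H !trmx_mul !map_mxM trmxCK Dh mulmxA.
  - by rewrite /H -!mulmxA (mulmxA S) SK mul1mx (mulmxA D) DD.
  - rewrite /H mxtrace_mulC mulmxA SK mul1mx mxtrace_diag.
    under eq_bigr do rewrite mxE.
    have -> : \sum_i (i \in I)%:R = #|I|%:R :> R[i].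
      rewrite -sum1_card natr_sum [RHS]big_mkcond.
      by apply: eq_bigr => i _; case: (i \in I).
    by rewrite cardI.
have trHB : \tr (H *m B) = \sum_(i in I) d 0 i.
  rewrite /H defB -!mulmxA (mulmxA S) SK mul1mx mxtrace_mulC -!mulmxA SK mulmx1.
  rewrite mulmx_diag mxtrace_diag [RHS]big_mkcond; apply: eq_bigr => i _.
  by rewrite !mxE; case: (i \in I); rewrite ?mul1r ?mul0r.
transitivity (complex.Re (\tr (H *m B))).
  rewrite trHB big_mkcond [in RHS]big_mkcond Re_sum.
  by apply: eq_bigr => i _; case: ifP.
rewrite Re_sum; apply: eq_bigr => i _.
rewrite mxE Re_sum; apply: eq_bigr => j _.
rewrite -[in RHS]symA [A^T i j]mxE [B j i]mxE.
by case: (H i j) => a b /=; rewrite mulr0 subr0.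
Qed.

End RealParts.

(** * Weights of edges and stars *)

Section Weights.
Variables (R : rcfType) (V : finType) (k : nat) (p : V -> V -> R).
Hypothesis projP : real_part_projection k p.

(* The quadratic form of p at 1_u - 1_v. *)
Definition weight u v : R := p u u + p v v - 2 * p u v.

Lemma weight_sym u v : weight u v = weight v u.
Proof. by rewrite /weight (rpp_sym projP u v) addrAC addrC addrA addrAC. Qed.

Lemma rpp_diag_ge0 u : 0 <= p u u.
Proof.
apply: le_trans (rpp_row projP u).
by apply: sumr_ge0 => v _; exact: sqr_ge0.
Qed.

Lemma sum_rpp_diag_le (A : {pred V}) : \sum_(v in A) p v v <= k%:R.
Proof.
rewrite -(rpp_trace projP) [leRHS](bigID (mem A)) /= lerDl.
by apply: sumr_ge0 => v _; exact: rpp_diag_ge0.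
Qed.

(** The test vector 1_u + s 1_v: s = -1 produces [weight], and s = 1 yields [weight_le_diag]. *)
Let pair (s : R) (u v : V) a : R := (a == u)%:R + s * (a == v)%:R.

Let sum_pair s u v (F : V -> R) : \sum_a pair s u v a * F a = F u + s * F v.
Proof.
have sum_delta w : \sum_a (a == w)%:R * F a = F w.
  rewrite (bigD1 w) //= eqxx mul1r big1 ?addr0 // => a /negPf ->.
  by rewrite mul0r.
under eq_bigr do rewrite mulrDl -mulrA.
by rewrite big_split -mulr_sumr !sum_delta.
Qed.

Let quad_pair s u v :
  \sum_a \sum_b pair s u v a * pair s u v b * p a b
    = p u u + 2 * s * p u v + s ^+ 2 * p v v.
Proof.
under eq_bigr do (under eq_bigr do rewrite -mulrA; rewrite -mulr_sumr sum_pair).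
by rewrite sum_pair (rpp_sym projP v u); ring.
Qed.

Lemma weight_ge0 u v : 0 <= weight u v.
Proof.
have := rpp_ge0 projP (pair (-1) u v); rewrite quad_pair /weight; lra.
Qed.

Lemma weight_le2 u v : weight u v <= 2.
Proof.
have [-> | uv] := eqVneq u v; first by rewrite /weight; lra.
have := rpp_le1 projP (pair (-1) u v); rewrite quad_pair /weight.
under eq_bigr do rewrite expr2.
rewrite sum_pair /pair !eqxx (negPf uv) eq_sym (negPf uv) /=; lra.
Qed.

Lemma weight_le_diag u v : weight u v <= 2 * (p u u + p v v).
Proof.
have := rpp_ge0 projP (pair 1 u v); rewrite quad_pair /weight; lra.
Qed.

Lemma sum_rpp_set_ge0 (A : {pred V}) : 0 <= \sum_(u in A) \sum_(v in A) p u v.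
Proof.
have := rpp_ge0 projP (fun u => (u \in A)%:R); congr (_ <= _).
rewrite [RHS]big_mkcond; apply: eq_bigr => u _; rewrite [in RHS]big_mkcond.
case: (u \in A); last by rewrite big1 // => v _; rewrite !mul0r.
apply: eq_bigr => v _.
by case: (v \in A); rewrite ?mulr1 ?mul1r ?mulr0 ?mul0r.
Qed.

(* With q = 1 - p c c, each term is p v v - q - 2 p c v, and AM-GM gives
   -2 p c v <= q + p c v ^ 2 / q, where the squares in row c sum to at most
   p c c - p c c ^ 2 = q * p c c. *)
Lemma star_weight_le (c : V) (N : {pred V}) : c \notin N ->
  \sum_(v in N) (weight c v - 1) <= k%:R.
Proof.
move=> cN; pose q := 1 - p c c.
have row_c : \sum_(v in N) p c v ^+ 2 <= q * p c c.
  have := rpp_row projP c; rewrite (bigD1 c) //=.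
  have : \sum_(v in N) p c v ^+ 2 <= \sum_(v | v != c) p c v ^+ 2.
    rewrite [leRHS](bigID (mem N)) /= [X in _ <= X + _](eq_bigl (mem N)).
      by rewrite lerDl; apply: sumr_ge0 => v _; exact: sqr_ge0.
    by move=> v /=; rewrite andb_idl //; apply: contraTneq => ->.
  rewrite /q expr2; lra.
have [q0 | q0] := eqVneq q 0.
  (* Here [row_c] forces p c v = 0 on N, and each term reduces to p v v. *)
  rewrite q0 mul0r in row_c.
  apply: le_trans (sum_rpp_diag_le N); apply: ler_sum => v vN.
  have /eqP : p c v ^+ 2 = 0.
    apply/le_anti; rewrite sqr_ge0 andbT; apply: le_trans row_c.
    by rewrite (bigD1 v) //= lerDl; apply: sumr_ge0 => u _; exact: sqr_ge0.
  by rewrite sqrf_eq0 => /eqP pcv; move: q0; rewrite /q /weight pcv; lra.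
have q_gt0 : 0 < q.
  rewrite lt0r q0 /q subr_ge0.
  have := rpp_row projP c; rewrite (bigD1 c) //=.
  have : 0 <= \sum_(i | i != c) p c i ^+ 2.
    by apply: sumr_ge0 => v _; exact: sqr_ge0.
  have := rpp_diag_ge0 c; nra.
apply: (@le_trans _ _ (\sum_(v in N) (p v v + q^-1 * p c v ^+ 2))).
  apply: ler_sum => v _.
  have : 0 <= q^-1 * (p c v + q) ^+ 2.
    by rewrite mulr_ge0 ?invr_ge0 ?sqr_ge0 // ltW.
  have -> : q^-1 * (p c v + q) ^+ 2 = q^-1 * p c v ^+ 2 + 2 * p c v + q.
    by field.
  by rewrite /weight /q; lra.
rewrite big_split -mulr_sumr /=.
apply: (@le_trans _ _ (\sum_(v in N) p v v + p c c)).
  by rewrite lerD2l ler_pdivrMl.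
(* As c is not in N, p c c completes the diagonal sum over N and c. *)
apply: le_trans (sum_rpp_diag_le [predU1 c & N]).
rewrite addrC [leRHS](bigD1 c) /= ?inE ?eqxx // lerD2l le_eqVlt.
apply/orP; left; apply/eqP/eq_bigl => v; rewrite !inE.
by case: eqVneq => [-> | _]; rewrite ?(negPf cN) ?andbT.
Qed.

End Weights.

(** The moved points fall into pairs x, m x; [A] takes the point of smaller rank from each pair. *)
Lemma odd_card_support_involutive (T : finType) (m : T -> T) :
  involutive m -> ~~ odd #|[set x | m x != x]|.
Proof.
move=> mK; pose A := [set x | (enum_rank x < enum_rank (m x))%N].
have -> : [set x | m x != x] = A :|: m @: A.
  apply/setP => x; rewrite !inE.
  rewrite -[x in RHS]mK (mem_imset _ _ (inv_inj mK)).
  by rewrite !inE mK -neq_ltn (inj_eq val_inj) (inj_eq enum_rank_inj) eq_sym.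
rewrite cardsU disjoint_setI0 ?cards0 ?subn0.
  by rewrite card_imset ?addnn ?odd_double //; exact: inv_inj.
rewrite -setI_eq0; apply/eqP/setP => x; rewrite !inE.
rewrite -[X in X \in m @: _]mK (mem_imset _ _ (inv_inj mK)) !inE mK.
by case: ltngtP.
Qed.

(** * Maximum matchings and Gallai's relation *)

Section Matchings.
Variables (V : finType) (f : rel V).
Hypotheses (f_sym : symmetric f) (f_irr : irreflexive f).
Implicit Types (W : {set V}) (m n : {ffun V -> V}) (u v x y t : V).

Definition covered (m : V -> V) : {set V} := [set v | m v != v].

(* A matching is encoded by the involution that swaps the ends of each of its
   edges, so the number of edges is half the number of covered vertices. *)
Definition matching W m : bool :=
  [forall v, m (m v) == v]
    && [forall v, (m v != v) ==> f v (m v) && (v \in W)].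

(** Twice the matching number of the graph induced on [W]. *)
Definition max_covered W : nat := \max_(m | matching W m) #|covered m|.

Definition maximum W m : bool :=
  matching W m && (#|covered m| == max_covered W).

Lemma matchingP W m : reflect
  (involutive m /\ forall v, m v != v -> f v (m v) /\ v \in W) (matching W m).
Proof.
apply: (iffP andP) => [[/forallP mK /forallP mW] | [mK mW]]; split.
- by move=> v; apply/eqP.
- by move=> v mv; have := mW v; rewrite mv => /andP.
- by apply/forallP => v; rewrite mK.
- by apply/forallP => v; apply/implyP => /mW[-> ->].
Qed.

Lemma leq_max_covered W m : matching W m -> (#|covered m| <= max_covered W)%N.
Proof. exact: (@leq_bigmax_cond _ _ (fun m => #|covered m|)). Qed.

Lemma exists_maximum W : exists m, maximum W m.
Proof.
have [|m m_match def_max] :=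
  @eq_bigmax_cond _ (matching W) (fun m => #|covered m|).
  apply/card_gt0P; exists [ffun v => v]; apply/matchingP.
  by split=> v; rewrite !ffunE // eqxx.
by exists m; rewrite /maximum [matching W m]m_match -def_max eqxx.
Qed.

Lemma odd_max_covered W : odd (max_covered W) = false.
Proof.
have [m /andP[/matchingP[mK _] /eqP <-]] := exists_maximum W.
exact/negbTE/odd_card_support_involutive.
Qed.

Lemma matchingD1 W c m : matching (W :\ c) m = matching W m && (m c == c).
Proof.
apply/matchingP/andP => [[mK mW] | [/matchingP[mK mW] /eqP mc]]; split.
- apply/matchingP; split=> // v /mW; rewrite !inE => -[-> /andP[_ ->]].
  by [].
- by apply: contraT => /mW[_]; rewrite !inE eqxx.
- by [].
- move=> v mv; have [-> vW] := mW v mv; rewrite !inE vW andbT; split=> //.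
  by apply: contraNneq mv => ->; rewrite mc.
Qed.

(** A maximum matching of [W :\ c] is a matching of [W] missing c. If it is not maximum in [W],
    parity makes the gap at least 2, that is, one edge. *)
Lemma max_coveredD1 W c :
  (max_covered (W :\ c) + 2 <= max_covered W)%N
    \/ exists2 m, maximum W m & m c = c.
Proof.
have [m /andP[]] := exists_maximum (W :\ c); rewrite matchingD1.
move=> /andP[m_match /eqP mc] /eqP card_m.
have := leq_max_covered m_match.
rewrite card_m leq_eqVlt => /predU1P[eqm | ltm].
  by right; exists m => //; rewrite /maximum m_match card_m eqm eqxx.
left; move: ltm (odd_max_covered W) (odd_max_covered (W :\ c)); lia.
Qed.

(** For x unmatched in n, this adds the edge xy and frees the former partner of y. If y is unmatched
    too, the third branch is never reached, so one definition covers both augmentation and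
    exchange. *)
Definition match_pair n x y : {ffun V -> V} :=
  [ffun a => if a == x then y else if a == y then x
             else if a == n y then n y else n a].

Lemma match_pair_matching W n x y : matching W n -> f x y ->
  x \in W -> y \in W -> n x = x -> matching W (match_pair n x y).
Proof.
move=> /matchingP[nK nW] fxy xW yW nx.
have neq_xy : x != y by apply: contraTneq fxy => ->; rewrite f_irr.
have yx : (y == x) = false by rewrite eq_sym (negPf neq_xy).
apply/matchingP; split=> a; rewrite !ffunE.
  case: (eqVneq a x) => [-> | ax]; first by rewrite yx !eqxx.
  case: (eqVneq a y) => [-> | ay]; first by rewrite eqxx.
  case: (eqVneq a (n y)) => [any | any].
    by rewrite -any (negPf ax) (negPf ay) any eqxx.
  rewrite (can2_eq nK nK) nx (negPf ax) (can2_eq nK nK) (negPf any).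
  by rewrite (inj_eq (can_inj nK)) (negPf ay) nK.
case: (eqVneq a x) => [-> | ax] //.
case: (eqVneq a y) => [-> | ay]; first by rewrite f_sym.
by case: (eqVneq a (n y)) => [-> | any] => [/eqP | /nW].
Qed.

Lemma covered_match_pair n x y : involutive n -> x != y ->
  covered (match_pair n x y) = x |: (y |: (covered n :\ n y)).
Proof.
move=> nK neq_xy; apply/setP => a; rewrite !inE ffunE.
case: (eqVneq a x) => [-> | ax]; first by rewrite eq_sym.
case: (eqVneq a y) => [-> | ay]; first by rewrite neq_xy.
by case: (eqVneq a (n y)) => [-> | any]; rewrite ?eqxx.
Qed.

Lemma maximum_no_augment W m x y : maximum W m -> f x y ->
  x \in W -> y \in W -> m x = x -> m y != y.
Proof.
move=> /andP[m_match /eqP card_m] fxy xW yW mx; apply/eqP => my.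
have neq_xy : x != y by apply: contraTneq fxy => ->; rewrite f_irr.
have := leq_max_covered (match_pair_matching m_match fxy xW yW mx).
have [mK _] := matchingP _ _ m_match.
rewrite covered_match_pair // my.
have -> : covered m :\ y = covered m.
  apply/setP => a; rewrite !inE.
  by case: (eqVneq a y) => [-> |]; rewrite ?my ?eqxx.
by rewrite !cardsU1 !inE (negPf neq_xy) mx my !eqxx /= card_m; lia.
Qed.

(** Among the covered vertices, x merely replaces the former partner of y. *)
Lemma maximum_match_pair W m x y : maximum W m -> f x y ->
  x \in W -> y \in W -> m x = x -> maximum W (match_pair m x y).
Proof.
move=> m_max fxy xW yW mx.
have my := maximum_no_augment m_max fxy xW yW mx.
case/andP: m_max => m_match /eqP card_m.
have neq_xy : x != y by apply: contraTneq fxy => ->; rewrite f_irr.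
have [mK _] := matchingP _ _ m_match.
rewrite /maximum match_pair_matching // covered_match_pair // -card_m.
have ->: y |: (covered m :\ m y) = covered m :\ m y.
  apply/setP => a; rewrite !inE.
  by case: (eqVneq a y) => [-> |] //=; rewrite eq_sym my.
rewrite cardsU1 !inE mx eqxx andbF /= add1n (cardsD1 (m y) (covered m)) !inE.
by rewrite mK [y == _]eq_sym my.
Qed.

Definition inseparable W u v : bool :=
  (u == v) || [forall m, maximum W m ==> (m u != u) || (m v != v)].

Lemma inseparable_refl W : reflexive (inseparable W).
Proof. by move=> u; rewrite /inseparable eqxx. Qed.

Lemma inseparable_sym W : symmetric (inseparable W).
Proof.
move=> u v; rewrite /inseparable eq_sym; congr (_ || _).
by apply: eq_forallb => m; rewrite orbC.
Qed.

Lemma edge_inseparable W u v : u \in W -> v \in W -> f u v -> inseparable W u v.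
Proof.
move=> uW vW fuv; apply/orP; right; apply/forallP => m; apply/implyP => m_max.
by case: (eqVneq (m u) u) => //= /(maximum_no_augment m_max fuv uW vW).
Qed.

(* Gallai's exchange argument.  Suppose that M misses both u and v, and let N
   miss t and agree with M as much as possible.  As N covers u and v, some
   edge xy of M has x <> t missed by N; matching x with y in N, in place of the
   former partner of y, increases the agreement. *)
Lemma inseparable_trans W t u v :
    (exists2 m, maximum W m & m t = t) ->
  inseparable W u t -> inseparable W t v -> inseparable W u v.
Proof.
move=> [m0 m0_max m0t].
rewrite {1}/inseparable => /predU1P[-> // | /forallP ut].
rewrite {1}/inseparable => /predU1P[<- | /forallP tv].
  by apply/orP; right; apply/forallP.
apply/orP; case: eqVneq => [_ | uv]; [by left | right].
apply/forallP => M; apply/implyP => M_max; apply: contraT.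
rewrite negb_or !negbK => /andP[/eqP Mu /eqP Mv].
pose agree n := [set a | (M a == n a) && (M a != a)].
have m0_ok : maximum W m0 && (m0 t == t) by rewrite m0_max m0t eqxx.
case: (@arg_maxnP _ m0 (fun n => maximum W n && (n t == t))
  (fun n => #|agree n|) m0_ok).
move=> N /andP[N_max /eqP Nt] N_best.
have /implyP/(_ N_max) := ut N; rewrite Nt eqxx orbF => Nu.
have /implyP/(_ N_max) := tv N; rewrite Nt eqxx => /= Nv.
have [M_match /eqP card_M] := andP M_max.
have [N_match /eqP card_N] := andP N_max.
have [MK MW] := matchingP _ _ M_match; have [NK _] := matchingP _ _ N_match.
have [x /and3P[xt Mx /eqP Nx]] : exists x, [&& x != t, M x != x & N x == x].
  (* Otherwise N covers all that M covers, except possibly t, and also u and v, which M misses; M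
     would then cover fewer vertices than N. *)
  apply/existsP; apply: contraT => /existsPn no_x.
  have sub : covered M \subset t |: (covered N :\ u :\ v).
    apply/subsetP => a; rewrite !inE => Ma.
    have := no_x a; rewrite Ma /= negb_and negbK.
    case: (a == t) => //= ->; rewrite andbT.
    by apply/andP; split; apply: contraNneq Ma => ->; rewrite ?Mu ?Mv.
  have := leq_b1 (t \notin covered N :\ u :\ v).
  have := subset_leq_card sub; rewrite cardsU1 card_M -card_N.
  rewrite (cardsD1 u (covered N)) (cardsD1 v (covered N :\ u)) !inE Nu Nv.
  by rewrite eq_sym uv; lia.
have [fxy xW] := MW x Mx; have [_ yW] : f (M x) (M (M x)) /\ M x \in W.
  by apply: MW; rewrite MK eq_sym.
have N'_max := maximum_match_pair N_max fxy xW yW Nx.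
have Ny := maximum_no_augment N_max fxy xW yW Nx.
set y := M x in fxy yW N'_max Ny; set N' := match_pair N x y in N'_max.
have neq_ty : t != y by apply: contraNneq Ny => <-; rewrite Nt.
have neq_tNy : t != N y.
  by apply: contraNneq neq_ty => tNy; rewrite -Nt tNy NK.
have N't : N' t = t.
  by rewrite ffunE eq_sym (negPf xt) (negPf neq_ty) (negPf neq_tNy).
have /N_best : maximum W N' && (N' t == t) by rewrite N'_max N't eqxx.
rewrite /= leqNgt => /negP[]; apply: proper_card.
apply/properP; split; last first.
  by exists x; rewrite !inE ?ffunE ?eqxx ?Mx // Nx (negPf Mx).
(* Only x, y and N y change partners. At x and y the new matching follows M, and at N y there was no
   agreement to lose, as M pairs y with x and N y differs from x. *)
have Ny_x : N y != x.
  by apply: contraNneq Mx => Nyx; rewrite -[M x]NK -/y Nyx Nx.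
apply/subsetP => a; rewrite !inE => /andP[/eqP MNa Ma]; rewrite Ma andbT ffunE.
case: (eqVneq a x) => [ax | ax]; first by rewrite ax.
case: (eqVneq a y) => [ay | ay]; first by rewrite ay /y MK.
case: (eqVneq a (N y)) => [aNy | aNy]; last by apply/eqP.
move: MNa Ny_x; rewrite aNy NK => /(congr1 M); rewrite MK => ->.
by rewrite /y MK eqxx.
Qed.

(** A maximum matching misses at most one vertex of a class and covers the others; the hypothesis
    supplies transitivity. *)
Lemma card_inseparable W u :
    (forall v, v \in W -> exists2 m, maximum W m & m v = v) -> u \in W ->
  (#|[set v in W | inseparable W u v]| <= (max_covered W).+1)%N.
Proof.
move=> miss uW; set C := [set v in W | _].
have [m m_max] := exists_maximum W; have [_ /eqP <-] := andP m_max.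
rewrite -(cardsID (covered m) C) -addn1 leq_add //.
  by apply: subset_leq_card; exact: subsetIr.
apply/card_le1_eqP => v1 v2; rewrite !inE !negbK.
move=> /andP[/eqP mv1 /andP[_ uv1]] /andP[/eqP mv2 /andP[_ uv2]].
have : inseparable W v1 v2.
  by apply: (inseparable_trans (miss u uW)); rewrite // inseparable_sym.
by move=> /predU1P[// | /forallP/(_ m)]; rewrite m_max mv1 mv2 !eqxx.
Qed.

End Matchings.

(** * Excess weight and matching number *)

Section Excess.
Variables (R : rcfType) (V : finType) (k : nat) (p : V -> V -> R).
Hypothesis projP : real_part_projection k p.
Variable f : rel V.
Hypotheses (f_sym : symmetric f) (f_irr : irreflexive f).
Let w := weight p.

(* Sums over ordered pairs: each edge counts twice. *)
Definition excess (W : {set V}) : R :=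
  \sum_(u in W) \sum_(v in W | f u v) (w u v - 1).

Definition arcs (W : {set V}) : {set V * V} :=
  [set q | [&& q.1 \in W, q.2 \in W & f q.1 q.2]].

Lemma odd_card_arcs W : odd #|arcs W| = false.
Proof.
pose m (q : V * V) := if q \in arcs W then (q.2, q.1) else q.
have -> : arcs W = [set q | m q != q].
  apply/setP => -[u v]; rewrite [RHS]inE /m.
  case: ifP => //=; last by rewrite eqxx.
  rewrite inE /= => /and3P[_ _ fuv]; apply/esym.
  by apply: contraTneq fuv => -[_ ->]; rewrite f_irr.
apply/negbTE/odd_card_support_involutive => -[u v]; rewrite /m.
have [uvA | /negPf uvA] := boolP ((u, v) \in arcs W); last by rewrite uvA.
by move: uvA; rewrite !inE /= f_sym => /and3P[-> -> ->].
Qed.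

Lemma sum_arcs (W : {set V}) (F : V -> V -> R) :
  \sum_(u in W) \sum_(v in W | f u v) F u v = \sum_(q in arcs W) F q.1 q.2.
Proof.
by rewrite pair_big_dep /=; apply: eq_bigl => -[u v]; rewrite !inE.
Qed.

Lemma excess_le_card W : excess W <= #|arcs W|%:R.
Proof.
rewrite /excess sum_arcs -sum1_card natr_sum; apply: ler_sum => q _.
by have := weight_le2 projP q.1 q.2; rewrite -/w; lra.
Qed.

Lemma excessE W :
  excess W = \sum_(u in W) \sum_(v in W | f u v) w u v - #|arcs W|%:R.
Proof. by rewrite /excess !sum_arcs sumrB -sum1_card natr_sum. Qed.

Lemma excessD1 (W : {set V}) c : c \in W ->
  excess W = excess (W :\ c) + 2 * \sum_(v in W | f c v) (w c v - 1).
Proof.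
move=> cW; rewrite /excess (big_setD1 c cW) /=.
have -> : \sum_(u in W :\ c) \sum_(v in W | f u v) (w u v - 1) =
    \sum_(u in W :\ c) (\sum_(v in W :\ c | f u v) (w u v - 1)
      + (if f c u then w c u - 1 else 0)).
  apply: eq_bigr => u _; rewrite !big_mkcondr /=.
  by rewrite (big_setD1 c cW) /= addrC f_sym /w (weight_sym projP c).
have starE : \sum_(v in W | f c v) (w c v - 1)
    = \sum_(u in W :\ c) (if f c u then w c u - 1 else 0).
  by rewrite big_mkcondr (big_setD1 c cW) /= f_irr add0r.
rewrite starE big_split /=.
by ring.
Qed.

(* Within a class C the weights of all pairs add up to at most
   2 |C| (trace of p on C), as the entries of p on C have a nonnegative sum. *)
Lemma sum_weight_equivalence (W : {set V}) (r : rel V) (n : nat) :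
    {in W & &, equivalence_rel r} ->
    {in W, forall u, #|[set v in W | r u v]| <= n}%N ->
    {in W &, forall u v, f u v -> r u v} ->
  \sum_(u in W) \sum_(v in W | f u v) w u v <= (2 * (n * k))%:R.
Proof.
move=> r_eq r_card fr; pose P := equivalence_partition r W.
have P_part : partition P W := equivalence_partitionP r_eq.
have classE C u : C \in P -> u \in C -> u \in W /\ [set v in W | r u v] = C.
  case/imsetP => x xW ->; rewrite inE => /andP[uW xu]; split=> //.
  apply/setP => v; rewrite !inE; case vW: (v \in W) => //=.
  by have [_ /(_ xu)->] := r_eq x u v xW uW vW.
(* Weights are nonnegative, so all pairs within a class may be added. *)
apply: (@le_trans _ _ (\sum_(C in P) \sum_(u in C) \sum_(v in C) w u v)).
  rewrite (set_partition_big _ P_part); apply: ler_sum => C CP.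
  apply: ler_sum => u uC; have [uW <-] := classE C u CP uC.
  rewrite big_mkcond [leRHS]big_mkcond; apply: ler_sum => v _; rewrite inE.
  case vW: (v \in W) => //=.
  case fuv: (f u v); first by rewrite (fr u v).
  by case: ifP => // _; exact: weight_ge0 projP _ _.
apply: (@le_trans _ _ (\sum_(C in P) \sum_(u in C) 2 * n%:R * p u u)).
  apply: ler_sum => C CP.
  have C_le : (#|C| <= n)%N.
    have [-> | [u uC]] := set_0Vmem C; first by rewrite cards0.
    by have [uW <-] := classE C u CP uC; exact: r_card.
  have -> : \sum_(u in C) \sum_(v in C) w u v
      = 2 * #|C|%:R * \sum_(u in C) p u u
      - 2 * \sum_(u in C) \sum_(v in C) p u v.
    rewrite /w /weight.
    under eq_bigr do rewrite sumrB big_split sumr_const -mulr_sumr /=.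
    rewrite sumrB big_split sumr_const -mulr_sumr /= sumrMnl.
    by rewrite -[_ *+ #|C|]mulr_natl; ring.
  rewrite -mulr_sumr.
  apply: (@le_trans _ _ (2 * #|C|%:R * \sum_(u in C) p u u)).
    by have := sum_rpp_set_ge0 projP (mem C); lra.
  rewrite ler_wpM2r ?ler_wpM2l ?ler_nat //.
  by apply: sumr_ge0 => u _; exact: rpp_diag_ge0 projP u.
rewrite -(set_partition_big _ P_part) -mulr_sumr !natrM mulrA.
by rewrite ler_wpM2l ?mulr_ge0 ?(sum_rpp_diag_le projP).
Qed.

(** Twice the bound k nu + floor(k/2), since [excess] counts each edge twice and [max_covered] is 2
    nu. *)
Lemma excess_le_max_covered W :
  excess W <= (k * max_covered f W + 2 * k./2)%:R.
Proof.
have [n] := ubnP #|W|; elim: n W => // n IHn W ltW.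
have [/existsP[c /andP[cW small]] | no_c] := boolP
    [exists c, (c \in W) && (max_covered f (W :\ c) + 2 <= max_covered f W)%N].
  have /IHn IH : (#|W :\ c| < n)%N by move: ltW; rewrite (cardsD1 c) cW.
  have star : \sum_(v in W | f c v) (w c v - 1) <= k%:R.
    apply: (star_weight_le projP (N := [pred v in W | f c v])).
    by rewrite inE f_irr andbF.
  rewrite (excessD1 cW).
  apply: (@le_trans _ _ (k * max_covered f (W :\ c) + 2 * k./2 + 2 * k)%:R).
    by rewrite natrD natrM lerD // ler_wpM2l.
  by rewrite ler_nat; nia.
(* No deletion lowers the matching number any more, so every vertex of W is missed by some maximum
   matching. *)
have miss v : v \in W -> exists2 m, maximum f W m & m v = v.
  move=> vW; have [small | //] := max_coveredD1 f W v.
  by case/existsP: no_c; exists v; rewrite vW.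
have r_eq : {in W & &, equivalence_rel (inseparable f W)}.
  move=> u v x uW vW xW; split=> [|uv]; first exact: inseparable_refl.
  apply/idP/idP; last exact: (inseparable_trans f_sym f_irr (miss v vW)).
  apply: (inseparable_trans f_sym f_irr (miss u uW)).
  by rewrite inseparable_sym.
have := sum_weight_equivalence r_eq (fun u => card_inseparable f_sym f_irr miss)
  (fun u v uW vW => edge_inseparable f_sym f_irr uW vW).
have := excess_le_card W; rewrite excessE.
set s := \sum_(u in W) _.
have [le1 | lt1] := leqP #|arcs W| (k * max_covered f W + 2 * k./2).
  by move=> /le_trans + _; apply; rewrite ler_nat.
move=> _ s_le.
apply: (@le_trans _ _ ((2 * ((max_covered f W).+1 * k))%:R - #|arcs W|%:R)).
  by rewrite lerD2r.
rewrite lerBlDr -natrD ler_nat.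
(* By parity, the number of arcs exceeds the claimed bound by at least 2; then 2 ceil(k/2) - 2 <= 2
   floor(k/2) suffices. *)
have km_even : odd (k * max_covered f W) = false.
  by rewrite oddM odd_max_covered andbF.
rewrite [(_.+1 * k)%N]mulnC mulnS.
move: km_even lt1 (odd_card_arcs W).
by move: (k * max_covered f W)%N #|arcs W| => t a; lia.
Qed.

(** Summing over covered vertices counts each matching edge twice, hence 4k instead of 2k. Each term
    exceeds 1, so the bound is strict, and parity improves it to 4k - 2. *)
Lemma max_covered_le W : (forall u v, f u v -> 1 < w u v) -> (0 < k)%N ->
  (max_covered f W <= 4 * k - 2)%N.
Proof.
move=> f_gt1 k_gt0.
have [m /andP[/matchingP[mK mW] /eqP card_m]] := exists_maximum f W.
have m_odd := odd_max_covered f W.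
suff : (max_covered f W <= 4 * k)%N /\ (max_covered f W != 4 * k)%N.
  by case=> + /eqP; lia.
have le4k : \sum_(v in covered m) w v (m v) <= (4 * k)%:R.
  apply: (@le_trans _ _ (\sum_(v in covered m) 2 * (p v v + p (m v) (m v)))).
    by apply: ler_sum => v _; exact: weight_le_diag projP _ _.
  rewrite -mulr_sumr big_split /=.
  have <- : \sum_(v in covered m) p v v = \sum_(v in covered m) p (m v) (m v).
    rewrite (reindex_inj (inv_inj mK)); apply: eq_bigl => v.
    by rewrite !inE mK eq_sym.
  by have := sum_rpp_diag_le projP (covered m); rewrite natrM; lra.
have [s0 | [v0 v0m]] := set_0Vmem (covered m).
  by rewrite -card_m s0 cards0; lia.
suff : (max_covered f W)%:R < (4 * k)%:R :> R by rewrite ltr_nat; lia.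
apply: lt_le_trans le4k; rewrite -card_m -sum1_card natr_sum.
apply: ltr_sum; last by move=> v; rewrite inE => /mW[/f_gt1].
by apply/hasP; exists v0; rewrite ?mem_index_enum.
Qed.

End Excess.

(** * The Laplacian *)

Lemma real_part_projection_reindex (R : rcfType) (I V : finType) k
    (p : I -> I -> R) (h : V -> I) :
  bijective h -> real_part_projection k p ->
  real_part_projection k (fun u v => p (h u) (h v)).
Proof.
move=> [g hK gK] projP.
have sum_h (F : I -> R) : \sum_v F (h v) = \sum_i F i.
  by rewrite [RHS](reindex h) //; exists g => ? _.
have quad_h (x : V -> R) : \sum_u \sum_v x u * x v * p (h u) (h v)
    = \sum_i \sum_j x (g i) * x (g j) * p i j.
  rewrite -sum_h; apply: eq_bigr => u _.
  by rewrite -sum_h; apply: eq_bigr => v _; rewrite !hK.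
split=> [u v||x|x|u].
- exact: rpp_sym projP _ _.
- by rewrite (sum_h (fun i => p i i)) (rpp_trace projP).
- by rewrite quad_h (rpp_ge0 projP).
- rewrite quad_h; apply: le_trans (rpp_le1 projP _) _.
  by rewrite -sum_h; under eq_bigr do rewrite hK.
- by rewrite (sum_h (fun i => p (h u) i ^+ 2)) (rpp_row projP).
Qed.

(** Only (u, v) and (v, u) can have the end set {u, v}. *)
Lemma card_arcs_edge_set (V : finType) (e : rel V) :
  (#|arcs e [set: V]| <= 2 * #|edge_set e|)%N.
Proof.
pose ends (q : V * V) := [set q.1; q.2].
rewrite -sum1_card (partition_big ends (mem (edge_set e))) /=; last first.
  move=> q; rewrite inE => /and3P[_ _ qe].
  by apply/imsetP; exists q; rewrite ?inE.
rewrite mulnC -sum_nat_const; apply: leq_sum => E /imsetP[[u v] _ ->] /=.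
rewrite sum1_card.
apply: leq_trans (_ : (#|[set (u, v); (v, u)]| <= _)%N); last first.
  by rewrite cards2; case: (_ != _).
apply: subset_leq_card; apply/subsetP => -[a b].
rewrite !inE /ends /= => /andP[_ /eqP eq_ab].
have : (a \in [set u; v]) && (b \in [set u; v]).
  by rewrite -eq_ab !inE !eqxx orbT.
have : (u \in [set a; b]) && (v \in [set a; b]).
  by rewrite eq_ab !inE !eqxx orbT.
rewrite !inE !xpair_eqE (eq_sym u a) (eq_sym u b) (eq_sym v a) (eq_sym v b).
by do 4![case: (_ == _)].
Qed.

(** Row u contributes p u u - p u v for each neighbour v, and the two directions of an edge add up
    to its weight. *)
Lemma trace_laplacian (R : rcfType) (V : finType) (e : rel V) k
    (p : V -> V -> R) :
    symmetric e -> irreflexive e -> real_part_projection k p ->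
  2 * (\sum_u \sum_v p u v * laplacian e R (enum_rank u) (enum_rank v))
    = \sum_u \sum_(v | e u v) weight p u v.
Proof.
move=> e_sym e_irr projP.
have -> : \sum_u \sum_v p u v * laplacian e R (enum_rank u) (enum_rank v)
    = \sum_u \sum_(v | e u v) (p u u - p u v).
  apply: eq_bigr => u _; rewrite (bigD1 u) //= [in RHS]sumrB sumr_const.
  rewrite mxE /= !enum_rankK eqxx /degree cardsE mulr_natr; congr (_ + _).
  rewrite -sumrN [RHS]big_mkcond [RHS](bigD1 u) //= e_irr add0r.
  apply: eq_bigr => v /negPf vu; rewrite mxE /= !enum_rankK eq_sym vu.
  by case: ifP; rewrite ?mulrN1 ?mulr0.
have swap : \sum_u \sum_(v | e u v) p v v = \sum_u \sum_(v | e u v) p u u.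
  rewrite (exchange_big_dep predT) //=; apply: eq_bigr => u _.
  by apply: eq_bigl => v; rewrite e_sym.
rewrite /weight.
under eq_bigr do rewrite sumrB.
under [RHS]eq_bigr do rewrite sumrB big_split -mulr_sumr /=.
by rewrite !sumrB big_split /= -mulr_sumr swap; ring.
Qed.

(* A finite simple graph on the vertex set V is given by its adjacency
   relation e; uphalf k is the ceiling of k / 2. *)
Theorem corollary1p6 (R : rcfType) (V : finType) (e : rel V)
    (V_nonempty : (0 < #|V|)%N) (e_sym : symmetric e) (e_irr : irreflexive e)
    (k : nat) (k_ge1 : (1 <= k)%N) (k_le : (k <= #|V|)%N) :
  \sum_(1 <= i < k.+1) lambda (laplacian e R) i
    <= #|edge_set e|%:R + 2 * k%:R ^+ 2 - (uphalf k)%:R.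
Proof.
have [p' proj' ->] := sum_eigenvalues_projection (tr_laplacian R e_sym) k_le.
have rank_bij : bijective (@enum_rank V) := enum_rank_bij V.
have projP := real_part_projection_reindex rank_bij proj'.
set p := (fun u v => p' _ _) in projP.
have -> : \sum_i \sum_j p' i j * laplacian e R i j
    = \sum_u \sum_v p u v * laplacian e R (enum_rank u) (enum_rank v).
  rewrite (reindex _ (onW_bij _ rank_bij)); apply: eq_bigr => u _.
  by rewrite (reindex _ (onW_bij _ rank_bij)).
pose f u v := e u v && (1 < weight p u v).
have f_sym : symmetric f.
  by move=> u v; rewrite /f e_sym (weight_sym projP).
have f_irr : irreflexive f by move=> u; rewrite /f e_irr.
have f_gt1 u v : f u v -> 1 < weight p u v by case/andP.
(* The discarded edges have weight at most 1, so their terms are nonpositive. *)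
have excess_le : excess p e setT <= excess p f setT.
  apply: ler_sum => u _; rewrite big_mkcond [leRHS]big_mkcond.
  apply: ler_sum => v _; rewrite !inE /f /=.
  by case: (e u v) => //=; case: ltP => //; lra.
have : excess p f setT <= (k * (4 * k - 2) + 2 * k./2)%:R.
  apply: le_trans (excess_le_max_covered projP f_sym f_irr setT) _.
  by rewrite ler_nat leq_add2r leq_mul2l (max_covered_le projP) ?orbT.
have := trace_laplacian e_sym e_irr projP.
have arcsE : excess p e setT
    = \sum_u \sum_(v | e u v) weight p u v - #|arcs e setT|%:R.
  rewrite excessE; congr (_ - _).
  apply: eq_big => [u|u _]; first by rewrite inE.
  by apply: eq_bigl => v; rewrite inE.
move: excess_le; rewrite arcsE.
have : #|arcs e setT|%:R <= (2 * #|edge_set e|)%:R :> R.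
  by rewrite ler_nat card_arcs_edge_set.
(* The constant is doubled like the rest; floor(k/2) + ceil(k/2) = k gives the identity. *)
have -> : (k * (4 * k - 2) + 2 * k./2)%:R
    = 2 * (2 * k%:R ^+ 2 - (uphalf k)%:R) :> R.
  have : (k * (4 * k - 2) + 2 * k./2 + 2 * uphalf k = 4 * k ^ 2)%N.
    have -> : (k * (4 * k - 2) = 4 * k ^ 2 - 2 * k)%N.
      by rewrite mulnBr [(k * 2)%N]mulnC mulnCA mulnn.
    have : (2 * k <= 4 * k ^ 2)%N by rewrite -mulnn; nia.
    by move: (4 * k ^ 2)%N => t; lia.
  move/(congr1 (fun n => n%:R : R)).
  rewrite natrD [(4 * _)%:R]natrM natrX natrM.
  by lra.
by rewrite natrM; lra.
Qed.
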